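(* Let $D=\mathrm{diag}(\lambda_1,\dots,\lambda_d)$ be a $d\times d$ diagonal matrix with $\lambda_1\geqslant\dots\geqslant\lambda_d>0$. Let $V\geqslant 1/\sqrt d$ and consider a sequence of vectors $v^{(1)},v^{(2)},\dots\in\mathbb{R}^d$ such that $\|v^{(k)}\|_\infty\leqslant V$ for all $k$. For $m\in\mathbb{N}=\{0,1,2,\dots\}$, let $$A^{(m)} = D +\sqrt{D} \sum_{k=1}^m v^{(k)}[v^{(k)}]^T \sqrt{D},$$ let $\nu^{(m)}_1\geqslant\dots\geqslant\nu^{(m)}_d$ be the eigenvalues of $A^{(m)}$ (counted with multiplicity), and let $(e_1^{(m)},\dots,e_d^{(m)})$ be a corresponding orthonormal system of eigenvectors, i.e. $A^{(m)}e_i^{(m)}=\nu_i^{(m)}e_i^{(m)}$. Then $$\left|[e_i^{(m)}]_j\right| \leqslant C_m\sqrt{\frac{\min\{\lambda_i,\lambda_j\}}{\max\{\lambda_i,\lambda_j\}}}\quad\text{for all } i,j\in\{1,\dots,d\} \text{ and } m\in\mathbb{N},$$ where $C_0=1$ and $C_{m+1} = 5d^7V^4C_m^5\sqrt{1+dmV^2}$ for $m\in\mathbb{N}$.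
   Context: $[x]_j$ denotes the $j$-th coordinate of $x\in\mathbb{R}^d$, $\|x\|_\infty=\max_j|[x]_j|$, and $\sqrt{D}=\mathrm{diag}(\sqrt{\lambda_1},\dots,\sqrt{\lambda_d})$. For $m=0$ the sum is empty, so $A^{(0)}=D$. *)

(* Defs.v *)
From mathcomp Require Export all_boot all_order all_algebra.
From mathcomp Require Export reals normedtype.
Export Order.TTheory GRing.Theory Num.Theory numFieldNormedType.Exports.

Set Implicit Arguments.
Unset Strict Implicit.
Unset Printing Implicit Defensive.

Local Open Scope ring_scope.

(* Indices 1, ..., d are represented by 'I_d, hence shifted to 0, ..., d - 1. *)

Definition diagD (R : realType) (d : nat) (lam : 'rV[R]_d) : 'M[R]_d :=
  diag_mx lam.

Definition sqrtD (R : realType) (d : nat) (lam : 'rV[R]_d) : 'M[R]_d :=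
  diag_mx (map_mx Num.sqrt lam).

(* The sequence v is indexed from 1: the value v 0 is never used. *)
Definition Amx (R : realType) (d : nat) (lam : 'rV[R]_d) (v : nat -> 'cV[R]_d)
    (m : nat) : 'M[R]_d :=
  diagD lam
  + sqrtD lam *m (\sum_(1 <= k < m.+1) v k *m (v k)^T) *m sqrtD lam.

(* The factorization of the characteristic polynomial says that nu lists the
   eigenvalues of A with their multiplicities. *)
Definition ordered_spectrum (R : realType) (d : nat) (A : 'M[R]_d)
    (nu : 'I_d -> R) : Prop :=
  char_poly A = \prod_(i < d) ('X - (nu i)%:P)
  /\ forall i j : 'I_d, (i <= j)%N -> nu j <= nu i.

Definition orthonormal_system (R : realType) (d : nat)
    (e : 'I_d -> 'cV[R]_d) : Prop :=
  forall i j : 'I_d, (e i)^T *m e j = ((i == j)%:R)%:M.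

Fixpoint Cconst (R : realType) (d : nat) (V : R) (m : nat) : R :=
  if m is n.+1 then
    5%:R * d%:R ^+ 7 * V ^+ 4 * Cconst d V n ^+ 5
      * Num.sqrt (1 + d%:R * n%:R * V ^+ 2)
  else 1.

(* Main.v *)
Require Import Defs.
From mathcomp Require Import ring lra.

(** In the order of quadratic forms, [D <= A <= kappa D] with
    [kappa = 1 + d m V^2].  By the Courant-Fischer principle
    [lambda_i <= nu_i <= kappa lambda_i].  For a unit eigenvector [e_i],
    comparing [A] with [D] at [e_i] gives [lambda_j [e_i]_j^2 <= nu_i], and the
    spectral decomposition of the diagonal entry [A_jj] gives
    [nu_i [e_i]_j^2 <= A_jj <= kappa lambda_j].  Hence [[e_i]_j^2] is at most
    [kappa] times the ratio of the minimum to the maximum of [lambda_i] and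
    [lambda_j], and [sqrt kappa <= C_m]. *)

Set Implicit Arguments.
Unset Strict Implicit.
Unset Printing Implicit Defensive.

Local Open Scope ring_scope.

(** * Quadratic forms and preliminary inequalities *)

Definition qform (R : pzRingType) (d : nat) (A : 'M[R]_d) (u : 'rV[R]_d) : R :=
  (u *m A *m u^T) 0 0.

Lemma qform_diag (R : comPzRingType) (d : nat) (a u : 'rV[R]_d) :
  qform (diag_mx a) u = \sum_j a 0 j * u 0 j ^+ 2.
Proof.
rewrite /qform mul_mx_diag mxE; apply: eq_bigr => j _.
by rewrite !mxE; ring.
Qed.

Lemma qform_delta (R : pzRingType) (d : nat) (A : 'M[R]_d) (j : 'I_d) :
  qform A (delta_mx 0 j) = A j j.
Proof. by rewrite /qform trmx_delta -rowE -colE !mxE. Qed.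

Lemma qform_sum_outer (R : comPzRingType) (d : nat) (v : nat -> 'cV[R]_d)
    (m n : nat) (u : 'rV[R]_d) :
  qform (\sum_(m <= k < n) v k *m (v k)^T) u =
  \sum_(m <= k < n) (\sum_j u 0 j * v k j 0) ^+ 2.
Proof.
rewrite /qform mulmx_sumr mulmx_suml summxE; apply: eq_bigr => k _.
rewrite mulmxA -mulmxA -trmx_mul mxE big_ord1 [X in _ * X]mxE -expr2.
by rewrite mxE.
Qed.

(** Cauchy-Schwarz against the all-ones vector, from the nonnegativity of the sum of all squared
    differences. *)
Lemma sqr_sum_le (R : realDomainType) (d : nat) (t : 'I_d -> R) :
  (\sum_j t j) ^+ 2 <= d%:R * \sum_j t j ^+ 2.
Proof.
have : 0 <= \sum_i \sum_j (t i - t j) ^+ 2.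
  by apply: sumr_ge0 => i _; apply: sumr_ge0 => j _; apply: sqr_ge0.
have -> : \sum_i \sum_j (t i - t j) ^+ 2 =
    \sum_i (d%:R * t i ^+ 2 + \sum_j t j ^+ 2 - 2 * t i * \sum_j t j).
  apply: eq_bigr => i _.
  under eq_bigr => j _ do rewrite sqrrB.
  rewrite big_split big_split /= sumr_const card_ord sumrN.
  rewrite -mulr_natl mulr_sumr.
  under [X in _ - X + _ = _]eq_bigr => j _ do rewrite -mulr_natl mulrA.
  by ring.
rewrite sumrB big_split /= sumr_const card_ord -mulr_sumr -mulr_suml -mulr_sumr.
rewrite -mulr_natl.
(* The double sum has become [2 * (d * b - a ^+ 2)]. *)
by set a := \sum_j t j; set b := \sum_j _; nra.
Qed.

(* A matrix with a zero column is singular; keeping the columns of [P] before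
   [i] and those of [Q] after [i] leaves column [i] free for this. *)
Lemma common_kernel (F : fieldType) (d : nat) (P Q : 'M[F]_d) (i : 'I_d) :
  exists2 x : 'rV[F]_d, x != 0 &
    (forall b : 'I_d, (b < i)%N -> (x *m P) 0 b = 0) /\
    (forall b : 'I_d, (i < b)%N -> (x *m Q) 0 b = 0).
Proof.
pose T := \matrix_(a, b) (if (b < i)%N then P a b
                          else if (i < b)%N then Q a b else 0).
have /det0P [x x0 xT] : \det T == 0.
  rewrite -det_tr (expand_det_row _ i) big1 // => j _.
  by rewrite !mxE ltnn mul0r.
exists x => //; split=> b hb.
  transitivity ((x *m T) 0 b); last by rewrite xT mxE.
  by rewrite !mxE; apply: eq_bigr => a _; rewrite mxE hb.
transitivity ((x *m T) 0 b); last by rewrite xT mxE.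
by rewrite !mxE; apply: eq_bigr => a _; rewrite mxE hb ltnNge (ltnW hb).
Qed.

Lemma sum_sqr_gt0 (R : realDomainType) (d : nat) (x : 'rV[R]_d) :
  x != 0 -> 0 < \sum_j x 0 j ^+ 2.
Proof.
move=> x0; rewrite lt_def sumr_ge0 ?andbT; last by move=> *; apply: sqr_ge0.
apply: contra x0; rewrite psumr_eq0; last by move=> *; apply: sqr_ge0.
move=> /allP h; apply/eqP/rowP => j; rewrite mxE.
by have /(_ (mem_index_enum j)) := h j; rewrite sqrf_eq0 => /eqP.
Qed.

Lemma entry_le_norm (R : realType) (m n : nat) (A : 'M[R]_(m, n)) i j :
  `|A i j| <= `|A|.
Proof.
rewrite [leRHS]/Num.norm /= mx_normrE.
exact: (le_bigmax _ (fun ij : 'I_m * 'I_n => `|A ij.1 ij.2|) (i, j)).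
Qed.

(** * Spectral decomposition in an orthonormal eigenbasis *)

Section OrthonormalEigenbasis.

Variables (R : realType) (d : nat) (A : 'M[R]_d).
Variables (nu : 'I_d -> R) (e : 'I_d -> 'cV[R]_d).
Hypothesis e_orth : orthonormal_system e.
Hypothesis e_eig : forall i, A *m e i = nu i *: e i.

Let E : 'M[R]_d := \matrix_(a, b) e b a 0.

Let trE_E : E^T *m E = 1%:M.
Proof.
apply/matrixP => i j; rewrite !mxE.
have := congr1 (fun M : 'M_1 => M 0 0) (e_orth i j); rewrite !mxE mulr1n => <-.
by apply: eq_bigr => a _; rewrite !mxE.
Qed.

Let E_trE : E *m E^T = 1%:M.
Proof. exact: mulmx1C. Qed.

Let A_spectral : A = E *m diag_mx (\row_i nu i) *m E^T.
Proof.
suff -> : E *m diag_mx (\row_i nu i) = A *m E by rewrite -mulmxA E_trE mulmx1.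
apply/matrixP => i j; rewrite mul_mx_diag !mxE.
have := congr1 (fun M : 'cV_d => M i 0) (e_eig j); rewrite !mxE mulrC => <-.
by apply: eq_bigr => a _; rewrite mxE.
Qed.

Let E_entry (x : 'rV[R]_d) b : (x *m E) 0 b = (x *m e b) 0 0.
Proof. by rewrite !mxE; apply: eq_bigr => a _; rewrite mxE. Qed.

Lemma qform_eigenbasis (u : 'rV[R]_d) :
  qform A u = \sum_i nu i * (u *m e i) 0 0 ^+ 2.
Proof.
have -> : qform A u = qform (diag_mx (\row_i nu i)) (u *m E).
  by rewrite /qform [in LHS]A_spectral trmx_mul !mulmxA.
by rewrite qform_diag; apply: eq_bigr => i _; rewrite E_entry mxE.
Qed.

Lemma parseval (u : 'rV[R]_d) :
  \sum_i (u *m e i) 0 0 ^+ 2 = \sum_j u 0 j ^+ 2.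
Proof.
have sqE (w : 'rV[R]_d) : \sum_j w 0 j ^+ 2 = (w *m w^T) 0 0.
  by rewrite mxE; apply: eq_bigr => j _; rewrite mxE expr2.
rewrite sqE; have -> : u *m u^T = u *m E *m (u *m E)^T.
  by rewrite trmx_mul mulmxA -[u *m E *m _]mulmxA E_trE mulmx1.
by rewrite -sqE; apply: eq_bigr => i _; rewrite E_entry.
Qed.

Lemma qform_eigenvector (i : 'I_d) : qform A (e i)^T = nu i.
Proof.
by rewrite /qform trmxK -mulmxA e_eig -scalemxAr e_orth eqxx !mxE mulr1.
Qed.

(** In the spectral expansion of the diagonal entry all terms are nonnegative; the left side is the
    term of index [i]. *)
Lemma eigenvalue_sqr_entry_le (i j : 'I_d) :
  (forall b, 0 <= nu b) -> nu i * e i j 0 ^+ 2 <= A j j.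
Proof.
move=> nu_ge0; rewrite -qform_delta qform_eigenbasis (bigD1 i) //=.
rewrite -rowE mxE lerDl; apply: sumr_ge0 => b _.
by rewrite mulr_ge0 // sqr_ge0.
Qed.

(** * Comparison of eigenvalues and eigenvectors with a diagonal matrix *)

Variables (lam : 'rV[R]_d) (kappa : R).
Hypothesis lam_noninc : forall i j : 'I_d, (i <= j)%N -> lam 0 j <= lam 0 i.
Hypothesis nu_noninc : forall i j : 'I_d, (i <= j)%N -> nu j <= nu i.
Hypothesis diag_le : forall u, qform (diag_mx lam) u <= qform A u.
Hypothesis le_diag : forall u, qform A u <= kappa * qform (diag_mx lam) u.

(** Some nonzero [x] lies both in the span of the coordinate vectors up to [i] and in that of the
    eigenvectors from [i] on. There the form of the diagonal matrix is at least [lam 0 i] times the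
    squared norm, and that of [A] at most [nu i] times it. *)
Lemma eigenvalue_ge (i : 'I_d) : lam 0 i <= nu i.
Proof.
have [x x0 [xE x1]] := common_kernel E 1%:M i.
rewrite -(ler_pM2r (sum_sqr_gt0 x0)).
apply: (@le_trans _ _ (qform (diag_mx lam) x)).
  rewrite qform_diag mulr_sumr; apply: ler_sum => j _.
  have [/lam_noninc hj | hj] := leqP j i.
    by rewrite ler_wpM2r ?sqr_ge0.
  by move: (x1 _ hj); rewrite mulmx1 => ->; rewrite expr0n /= !mulr0.
apply: le_trans (diag_le x) _.
rewrite qform_eigenbasis -parseval mulr_sumr; apply: ler_sum => j _.
have [/nu_noninc hj | hj] := leqP i j.
  by rewrite ler_wpM2r ?sqr_ge0.
by rewrite -E_entry xE // expr0n /= !mulr0.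
Qed.

(** The mirror argument: [x] uses coordinates from [i] on and eigenvectors up to [i]. *)
Lemma eigenvalue_le (i : 'I_d) : 0 <= kappa -> nu i <= kappa * lam 0 i.
Proof.
move=> kappa_ge0; have [x x0 [x1 xE]] := common_kernel 1%:M E i.
rewrite -(ler_pM2r (sum_sqr_gt0 x0)).
apply: (@le_trans _ _ (qform A x)).
  rewrite qform_eigenbasis -parseval mulr_sumr; apply: ler_sum => j _.
  have [/nu_noninc hj | hj] := leqP j i.
    by rewrite ler_wpM2r ?sqr_ge0.
  by rewrite -E_entry xE // expr0n /= !mulr0.
apply: le_trans (le_diag x) _.
rewrite -mulrA ler_wpM2l // qform_diag mulr_sumr; apply: ler_sum => j _.
have [/lam_noninc hj | hj] := leqP i j.
  by rewrite ler_wpM2r ?sqr_ge0.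
by move: (x1 _ hj); rewrite mulmx1 => ->; rewrite expr0n /= !mulr0.
Qed.

Lemma eigenvector_entry_le (i j : 'I_d) :
  (forall b, 0 < lam 0 b) -> 0 <= kappa ->
  `|e i j 0| <= Num.sqrt kappa *
    Num.sqrt (Num.min (lam 0 i) (lam 0 j) / Num.max (lam 0 i) (lam 0 j)).
Proof.
move=> lam_gt0 kappa_ge0.
have max_gt0 : 0 < Num.max (lam 0 i) (lam 0 j) by rewrite lt_max lam_gt0.
rewrite -sqrtrM // -sqrtr_sqr; apply: ler_wsqrtr.
rewrite mulrA ler_pdivlMr //.
have nu_ge0 b : 0 <= nu b.
  by apply: le_trans (eigenvalue_ge b); apply: ltW.
have lam_i : e i j 0 ^+ 2 * lam 0 i <= kappa * lam 0 j.
  apply: (@le_trans _ _ (A j j)).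
    apply: le_trans (eigenvalue_sqr_entry_le i j nu_ge0).
    by rewrite mulrC ler_wpM2r ?sqr_ge0 ?eigenvalue_ge.
  rewrite -qform_delta; apply: le_trans (le_diag _) _.
  by rewrite qform_delta mxE eqxx mulr1n.
have lam_j : e i j 0 ^+ 2 * lam 0 j <= kappa * lam 0 i.
  apply: le_trans (eigenvalue_le i kappa_ge0).
  rewrite -qform_eigenvector; apply: le_trans (diag_le _).
  rewrite qform_diag (bigD1 j) //= mxE mulrC lerDl; apply: sumr_ge0 => b _.
  by rewrite mulr_ge0 ?sqr_ge0 // ltW.
(* After squaring and clearing the denominator, each order of the two entries of [lam] leaves one of
   the two bounds above. *)
by case: (leP (lam 0 i) (lam 0 j)).
Qed.

End OrthonormalEigenbasis.

(** * Quadratic form bounds for the perturbed matrix *)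

Section Amx.

Variables (R : realType) (d : nat) (lam : 'rV[R]_d) (v : nat -> 'cV[R]_d).

Lemma qform_Amx (m : nat) (u : 'rV[R]_d) :
  qform (Amx lam v m) u = qform (diag_mx lam) u +
    \sum_(1 <= k < m.+1) (\sum_j u 0 j * Num.sqrt (lam 0 j) * v k j 0) ^+ 2.
Proof.
rewrite {1}/qform /Amx mulmxDr mulmxDl mxE; congr (_ + _).
rewrite !mulmxA -[u *m _ *m _ *m _ *m _]mulmxA.
have -> : sqrtD lam *m u^T = (u *m sqrtD lam)^T by rewrite trmx_mul tr_diag_mx.
rewrite -/(qform _ _) qform_sum_outer; apply: eq_bigr => k _.
by congr (_ ^+ 2); apply: eq_bigr => j _; rewrite mul_mx_diag !mxE.
Qed.

Lemma qform_Amx_ge (m : nat) (u : 'rV[R]_d) :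
  qform (diag_mx lam) u <= qform (Amx lam v m) u.
Proof. by rewrite qform_Amx lerDl sumr_ge0 // => k _; apply: sqr_ge0. Qed.

(** Each of the [m] rank-one terms costs a factor [d] by Cauchy-Schwarz and a factor [V ^+ 2] from
    the bound on the entries of [v k]. *)
Lemma qform_Amx_le (V : R) (m : nat) (u : 'rV[R]_d) :
  (forall j, 0 <= lam 0 j) -> (forall k, (0 < k)%N -> `|v k| <= V) ->
  qform (Amx lam v m) u <= (1 + d%:R * m%:R * V ^+ 2) * qform (diag_mx lam) u.
Proof.
move=> lam_ge0 v_le; rewrite qform_Amx mulrDl mul1r lerD2l.
have -> : d%:R * m%:R * V ^+ 2 * qform (diag_mx lam) u =
    \sum_(1 <= k < m.+1) d%:R * (V ^+ 2 * qform (diag_mx lam) u).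
  by rewrite sumr_const_nat subSS subn0 -mulr_natl; ring.
rewrite !big_nat; apply: ler_sum => k /andP[k_gt0 _].
apply: le_trans (sqr_sum_le _) _; apply: ler_wpM2l => //.
rewrite qform_diag mulr_sumr; apply: ler_sum => j _.
rewrite exprMn exprMn sqr_sqrtr // mulrC [_ ^+ 2 * lam 0 j]mulrC.
apply: ler_wpM2r; first by rewrite mulr_ge0 ?sqr_ge0.
rewrite -(real_normK (num_real (v k j 0))) lerXn2r ?nnegrE //.
  exact: le_trans (v_le k k_gt0).
exact: le_trans (entry_le_norm _ _ _) (v_le k k_gt0).
Qed.

End Amx.

(** Induction on [m]: passing to [m.+1] multiplies the root by at most [Num.sqrt (1 + t)], which the
    factor in the recursion exceeds because [t >= 1]. *)
Lemma le_Cconst (R : realType) (d : nat) (V : R) (m : nat) :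
  (0 < d)%N -> 1 <= d%:R * V ^+ 2 ->
  Num.sqrt (1 + d%:R * m%:R * V ^+ 2) <= Cconst d V m.
Proof.
move=> d_gt0; set t := d%:R * V ^+ 2 => t_ge1.
have sqrt_ge1 n : 1 <= Num.sqrt (1 + d%:R * n%:R * V ^+ 2).
  rewrite -[leLHS]sqrtr1 ler_wsqrtr // lerDl.
  by rewrite -natrM mulr_ge0 ?sqr_ge0.
elim: m => [|m IHm] /=; first by rewrite mulr0 mul0r addr0 sqrtr1.
have C_ge1 : 1 <= Cconst d V m ^+ 5.
  by rewrite exprn_ege1 // (le_trans (sqrt_ge1 m)).
have s_ge0 : 0 <= d%:R * m%:R * V ^+ 2 by rewrite -natrM mulr_ge0 ?sqr_ge0.
(* Uses [1 + (m + 1) t <= (1 + t) (1 + m t)]. *)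
apply: (@le_trans _ _ (Num.sqrt (1 + t) * Num.sqrt (1 + d%:R * m%:R * V ^+ 2))).
  rewrite -sqrtrM ?ler_wsqrtr //; last by lra.
  have -> : d%:R * m.+1%:R * V ^+ 2 = d%:R * m%:R * V ^+ 2 + t.
    by rewrite /t -[m.+1]addn1 natrD; ring.
  by nra.
apply: ler_wpM2r; first exact: sqrtr_ge0.
have d_ge1 : 1 <= d%:R ^+ 5 :> R by rewrite exprn_ege1 // ler1n.
have -> : 5%:R * d%:R ^+ 7 * V ^+ 4 * Cconst d V m ^+ 5 =
    5%:R * t ^+ 2 * (d%:R ^+ 5 * Cconst d V m ^+ 5) by rewrite /t; ring.
have ge1 : 1 <= d%:R ^+ 5 * Cconst d V m ^+ 5 by rewrite mulr_ege1.
(* The chain is [Num.sqrt (1 + t) <= 1 + t <= 5 t ^+ 2], then the remaining factor is at least 1. *)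
apply: (@le_trans _ _ (1 + t)).
  rewrite -[leRHS]ger0_norm -?sqrtr_sqr ?ler_wsqrtr //; last by lra.
  by nra.
apply: (@le_trans _ _ (5%:R * t ^+ 2)); first by nra.
by rewrite ler_peMr // mulr_ge0 ?sqr_ge0.
Qed.

(* `|v k| is the library's norm on matrices: the maximum of the absolute values
   of the entries, i.e. the sup norm on column vectors. *)
Theorem theorem4 (R : realType) (d : nat) (lam : 'rV[R]_d) (V : R)
  (v : nat -> 'cV[R]_d)
  (nu : nat -> 'I_d -> R) (e : nat -> 'I_d -> 'cV[R]_d)
  (lam_noninc : forall i j : 'I_d, (i <= j)%N -> lam 0 j <= lam 0 i)
  (lam_gt0 : forall i : 'I_d, 0 < lam 0 i)
  (V_ge : 1 / Num.sqrt d%:R <= V)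
  (v_le : forall k : nat, (0 < k)%N -> `|v k| <= V)
  (nu_spec : forall m : nat, ordered_spectrum (Amx lam v m) (nu m))
  (e_orth : forall m : nat, orthonormal_system (e m))
  (e_eig : forall (m : nat) (i : 'I_d),
     Amx lam v m *m e m i = nu m i *: e m i) :
  forall (m : nat) (i j : 'I_d),
    `|e m i j 0| <= Cconst d V m *
      Num.sqrt (Num.min (lam 0 i) (lam 0 j) / Num.max (lam 0 i) (lam 0 j)).
Proof.
move=> m i j.
(* The index [i] itself witnesses that the dimension is positive. *)
have d_gt0 : (0 < d)%N := leq_ltn_trans (leq0n i) (ltn_ord i).
have sqrt_gt0 : 0 < Num.sqrt d%:R :> R by rewrite sqrtr_gt0 ltr0n.
have t_ge1 : 1 <= d%:R * V ^+ 2.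
  rewrite -[d%:R]sqr_sqrtr // -exprMn mulrC exprn_ege1 //.
  by rewrite -ler_pdivrMr.
have lam_ge0 b : 0 <= lam 0 b by apply: ltW.
have kappa_ge0 : 0 <= 1 + d%:R * m%:R * V ^+ 2.
  by rewrite addr_ge0 // -natrM mulr_ge0 ?sqr_ge0.
apply: (@le_trans _ _ (Num.sqrt (1 + d%:R * m%:R * V ^+ 2) *
  Num.sqrt (Num.min (lam 0 i) (lam 0 j) / Num.max (lam 0 i) (lam 0 j)))).
  apply: (eigenvector_entry_le (e_orth m) (e_eig m) lam_noninc
    (nu_spec m).2) => // u.
    exact: qform_Amx_ge.
  exact: qform_Amx_le.
by rewrite ler_wpM2r ?sqrtr_ge0 // le_Cconst.
Qed.
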